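(* Let $\{a_n\}_{n=0}^\infty$ be a sequence of complex numbers with $\sup_n |a_n|<\infty$, and let $f(z)=\sum_{n=0}^\infty a_n z^n$ for $z\in\mathbb{D}$. Suppose $I\subset\partial\mathbb{D}$ is an open interval such that $f$ has an analytic continuation to a neighborhood of $I$. Then every right limit of $\{a_n\}_{n=0}^\infty$ is reflectionless on $I$.
   Context: $\mathbb{D}=\{z\in\mathbb{C}: |z|<1\}$, $\partial\mathbb{D}$ is the unit circle, and an open interval $I\subset\partial\mathbb{D}$ means a nonempty open arc. That $f$ has an analytic continuation to a neighborhood of $I$ means that there are an open set $U\supset I$ and an analytic function on $\mathbb{D}\cup U$ which equals $f$ on $\mathbb{D}$. Right limit: for a bounded sequence $\{a_n\}_{n=0}^\infty$, a right limit is a two-sided sequence $\{b_n\}_{n=-\infty}^\infty$ for which there is a sequence of integers $n_j\to\infty$ with $b_n=\lim_{j\to\infty} a_{n+n_j}$ for every $n\in\mathbb{Z}$. Reflectionless: for a bounded two-sided sequence $\{b_n\}_{n=-\infty}^\infty$, put $f_+(z)=\sum_{n=0}^\infty b_n z^n$ for $z\in\mathbb{D}$ and $f_-(z)=\sum_{n=-\infty}^{-1} b_n z^n$ for $z\in(\mathbb{C}\cup\{\infty\})\setminus\overline{\mathbb{D}}$. The sequence is reflectionless on an open interval $I\subset\partial\mathbb{D}$ if and only if $f_+$ has an analytic continuation from $\mathbb{D}$ to $(\mathbb{C}\cup\{\infty\})\setminus(\partial\mathbb{D}\setminus I)$ such that on $(\mathbb{C}\cup\{\infty\})\setminus\overline{\mathbb{D}}$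 the continuation satisfies $f_+(z)+f_-(z)=0$. *)

(* Defs.v *)
From Stdlib Require Import Reals ZArith.
From Coquelicot Require Import Coquelicot.

Open Scope R_scope.

(* [CSeries u] is the sum of [u] when the series converges and is unspecified
   otherwise. *)
Definition CSeries (u : nat -> C) : C :=
  iota (T := CompleteNormedModule.CompleteSpace C_AbsRing C_CompleteNormedModule)
    (fun l : C => is_series (K := C_AbsRing) (V := C_NormedModule) u l).

Definition disk (z : C) : Prop := Cmod z < 1.

(* Arcs longer than 2 PI are allowed, so that the full circle is an open arc. *)
Definition open_arc (I : C -> Prop) : Prop :=
  exists alpha beta : R, alpha < beta /\
    forall z : C,
      I z <-> exists theta : R, alpha < theta < beta /\ z = (cos theta, sin theta).

(* Local representability by a convergent power series in a disk around [z0]. *)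
Definition analytic_at (f : C -> C) (z0 : C) : Prop :=
  exists (c : nat -> C) (r : R), 0 < r /\
    forall z : C, Cmod (z - z0) < r ->
      is_pseries (K := C_AbsRing) (V := C_NormedModule) c (z - z0)%C (f z).

Definition continues_near (f : C -> C) (I : C -> Prop) : Prop :=
  exists (U : C -> Prop) (g : C -> C),
    open (T := C_UniformSpace) U /\
    (forall z : C, I z -> U z) /\
    (forall z : C, disk z \/ U z -> analytic_at g z) /\
    (forall z : C, disk z -> g z = f z).

Inductive sphere : Type :=
  | Fin (z : C)
  | Inf.

Definition inv_sphere (w : C) : sphere :=
  if Ceq_dec w 0 then Inf else Fin (/ w).

(* At infinity, analyticity is tested in the coordinate w = 1/z. *)
Definition sphere_analytic_at (F : sphere -> C) (p : sphere) : Prop :=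
  match p with
  | Fin z => analytic_at (fun x => F (Fin x)) z
  | Inf => analytic_at (fun w => F (inv_sphere w)) 0
  end.

Definition slit_sphere (I : C -> Prop) (p : sphere) : Prop :=
  match p with
  | Fin z => ~ (Cmod z = 1 /\ ~ I z)
  | Inf => True
  end.

Definition exterior (p : sphere) : Prop :=
  match p with
  | Fin z => 1 < Cmod z
  | Inf => True
  end.

(* [Z.to_nat] truncates negative indices to 0; since [nj] tends to infinity this
   affects only finitely many [j] for each [n]. *)
Definition right_limit (a : nat -> C) (b : Z -> C) : Prop :=
  exists nj : nat -> Z,
    is_lim_seq (fun j => IZR (nj j)) p_infty /\
    forall n : Z,
      filterlim (fun j => a (Z.to_nat (n + nj j))) eventually
        (locally (T := C_UniformSpace) (b n)).

Definition f_plus (b : Z -> C) (z : C) : C :=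
  CSeries (fun n => (b (Z.of_nat n) * z ^ n)%C).

(* The index [k] stands for n = -(k+1), with z^n = (1/z)^(k+1); every such term
   vanishes at infinity. *)
Definition f_minus (b : Z -> C) (p : sphere) : C :=
  match p with
  | Fin z => CSeries (fun k => (b (- Z.of_nat (S k))%Z * (/ z) ^ (S k))%C)
  | Inf => 0
  end.

Definition reflectionless (b : Z -> C) (I : C -> Prop) : Prop :=
  (exists M : R, forall n : Z, Cmod (b n) <= M) /\
  exists F : sphere -> C,
    (forall p : sphere, slit_sphere I p -> sphere_analytic_at F p) /\
    (forall z : C, disk z -> F (Fin z) = f_plus b z) /\
    (forall p : sphere, exterior p -> (F p + f_minus b p)%C = 0).

(* Main.v *)
Require Import Defs.
From Stdlib Require Import Reals ZArith Lra Lia Classical ClassicalEpsilon.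
From Coquelicot Require Import Coquelicot.

Open Scope R_scope.

(** Let [g] be the continuation of [f], let [b] be the right limit along the
    shifts [m j + 1], and write [shifted a g m z] for
    [(g z - sum of a n * z ^ n over n <= m) / z ^ (m + 1)].
    In the unit disk this is the power series with coefficients
    [a (m + 1 + k)]; outside it is [g z / z ^ (m + 1)] minus a polynomial in
    [1 / z] whose coefficients are [a m, a (m - 1), ...]. The coefficients being
    bounded, along the shifts [m j] it converges, uniformly away from the unit
    circle, to [f_plus b] inside and to [- f_minus b] outside, because there
    [g z / z ^ (m + 1)] tends to 0 ([shifted_limit]). What remains is to see that
    the two limits are analytic continuations of each other across the arc.

    Let [z0] be a point of the arc, so that [g] is a power series around it. The
    shifted remainders are power series around [z0] as well, but near the
    unit circle they are only known to be bounded by a constant over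
    [|Cmod z - 1|], uniformly in [m] ([shifted_bound]). On a small circle of
    radius [rho] around [z0] multiply them by the square of the polynomial [h]
    that vanishes at the two points where this circle meets the unit circle.
    There [Cmod (h w)] is at most a multiple of [|Cmod (z0 + w) - 1|]
    ([crossing_factor]), so the products are uniformly small near the two
    crossing points and converge uniformly on the whole small circle. By the
    Cauchy estimate their Taylor coefficients at [z0] converge
    ([circle_limit_ana]). Dividing by the square of [h], which has no zero inside
    the small circle, gives a power series around [z0] that agrees with
    [f_plus b] inside the unit circle and with [- f_minus b] outside
    ([shifted_limit_on_arc]).

    The Cauchy estimate comes from averaging over the vertices of regular
    polygons inscribed in the circle. The same theorem on uniform limits
    re-expands the power series of [f_plus b] and [f_minus b] around
    other points ([ana_psum_comp]). *)

Implicit Types (u v a b c d : nat -> C) (f g p q : C -> C) (w z : C).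

(** * Limits and series of complex numbers *)

Definition tends (u : nat -> C) (l : C) : Prop :=
  forall eps : R, 0 < eps ->
    exists N, forall n, (N <= n)%nat -> Cmod (u n - l) < eps.

(** The codomain is [C] itself rather than a canonical structure over it, so that
    [ring] and [field] recognise the operations. *)
Definition csum (u : nat -> C) (n : nat) : C := sum_n (G := C_AbelianMonoid) u n.

Definition cseries (u : nat -> C) (l : C) : Prop :=
  is_series (K := C_AbsRing) (V := C_NormedModule) u l.

Lemma tends_filterlim u l :
  tends u l <-> filterlim u eventually (locally (T := C_UniformSpace) l).
Proof.
  split.
  - intros H.
    apply (proj2 (filterlim_locally_ball_norm (K := C_AbsRing) (U := C_NormedModule)
                    (F := eventually) u l)).
    intros eps. destruct (H eps (cond_pos eps)) as [N HN].
    exists N. intros n Hn. exact (HN n Hn).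
  - intros H eps Heps.
    destruct (proj1 (filterlim_locally_ball_norm (K := C_AbsRing) (U := C_NormedModule)
                    (F := eventually) u l) H (mkposreal eps Heps)) as [N HN].
    exists N. intros n Hn. exact (HN n Hn).
Qed.

Lemma cseries_tends u l : cseries u l <-> tends (csum u) l.
Proof. symmetry. apply tends_filterlim. Qed.

Lemma tends_unique u l l' : tends u l -> tends u l' -> l = l'.
Proof.
  intros H H'.
  apply (filterlim_locally_unique (K := C_AbsRing) (V := C_NormedModule)
           (F := eventually) u).
  - exact (proj1 (tends_filterlim u l) H).
  - exact (proj1 (tends_filterlim u l') H').
Qed.

Lemma CSeries_eq u l : cseries u l -> CSeries u = l.
Proof.
  intros H.
  apply (iota_unique (K := C_AbsRing) (V := C_CompleteNormedModule)); [ | exact H].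
  intros y Hy. apply tends_unique with (csum u); now apply cseries_tends.
Qed.

Lemma Cmod_minus_sym x y : Cmod (x - y) = Cmod (y - x).
Proof. rewrite <- Cmod_opp. f_equal. ring. Qed.

Lemma Cmod_triangle3 x y z : Cmod (x - z) <= Cmod (x - y) + Cmod (y - z).
Proof. replace (x - z)%C with ((x - y) + (y - z))%C by ring. apply Cmod_triangle. Qed.

Lemma Cmod_minus_le x y : Cmod (x - y) <= Cmod x + Cmod y.
Proof. rewrite <- (Cmod_opp y). apply Cmod_triangle. Qed.

Lemma tends_const l : tends (fun _ => l) l.
Proof.
  intros eps He. exists O. intros _ _.
  replace (l - l)%C with (RtoC 0) by ring. now rewrite Cmod_0.
Qed.

Lemma tends_ext_from u v l n0 :
  (forall n, (n0 <= n)%nat -> u n = v n) -> tends u l -> tends v l.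
Proof.
  intros E H eps He. destruct (H eps He) as [N HN].
  exists (max N n0). intros n Hn. rewrite <- E by lia. apply HN. lia.
Qed.

Lemma tends_scal x u l : tends u l -> tends (fun n => x * u n)%C (x * l)%C.
Proof.
  intros Hu eps He.
  pose proof (Cmod_ge_0 x) as Hx.
  destruct (Hu (eps / (Cmod x + 1))) as [N HN].
  { apply Rdiv_lt_0_compat; lra. }
  exists N. intros n Hn. specialize (HN n Hn).
  replace (x * u n - x * l)%C with (x * (u n - l))%C by ring.
  rewrite Cmod_mult.
  assert (E : (Cmod x + 1) * (eps / (Cmod x + 1)) = eps) by (field; lra).
  pose proof (Rmult_le_compat_l _ _ _ Hx (Rlt_le _ _ HN)).
  pose proof (Cmod_ge_0 (u n - l)). nra.
Qed.

(** Closed balls are closed. *)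
Lemma tends_ball u l x B :
  tends u l -> (exists N, forall n, (N <= n)%nat -> Cmod (u n - x) <= B) ->
  Cmod (l - x) <= B.
Proof.
  intros H [N HN]. apply Rnot_lt_le. intros Hlt.
  destruct (H (Cmod (l - x) - B)) as [N' HN']; [lra | ].
  specialize (HN (max N N') ltac:(lia)). specialize (HN' (max N N') ltac:(lia)).
  pose proof (Cmod_triangle3 l (u (max N N')) x) as T.
  rewrite (Cmod_minus_sym l (u _)) in T. lra.
Qed.

Lemma tends_bound u l B :
  tends u l -> (exists N, forall n, (N <= n)%nat -> Cmod (u n) <= B) -> Cmod l <= B.
Proof.
  intros H [N HN]. replace l with (l - 0)%C by ring.
  apply tends_ball with u; [exact H | ].
  exists N. intros n Hn. replace (u n - 0)%C with (u n) by ring. auto.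
Qed.

Lemma tends_cauchy u :
  (forall eps, 0 < eps -> exists N, forall n m, (N <= n)%nat -> (N <= m)%nat ->
     Cmod (u n - u m) < eps) ->
  exists l, tends u l.
Proof.
  intros H.
  destruct (proj1 (filterlim_locally_cauchy (U := C_CompleteNormedModule)
                     (F := eventually) u)) as [l Hl].
  - intros eps. destruct (H eps (cond_pos eps)) as [N HN].
    exists (fun n => exists k, (N <= k)%nat /\ u n = u k). split.
    + exists N. intros n Hn. exists n. auto.
    + intros n m [k [Hk ->]] [k' [Hk' ->]].
      apply (norm_compat1 (K := C_AbsRing) (V := C_NormedModule)).
      exact (HN k' k Hk' Hk).
  - exists l. apply tends_filterlim. exact Hl.
Qed.

Lemma csum_S u n : csum u (S n) = (csum u n + u (S n))%C.
Proof. exact (sum_Sn (G := C_AbelianMonoid) u n). Qed.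

Lemma csum_O u : csum u 0 = u 0%nat.
Proof. exact (sum_O (G := C_AbelianMonoid) u). Qed.

Lemma csum_ext u v n : (forall k, (k <= n)%nat -> u k = v k) -> csum u n = csum v n.
Proof. exact (sum_n_ext_loc (G := C_AbelianMonoid) u v n). Qed.

Lemma csum_scal x u n : csum (fun k => x * u k)%C n = (x * csum u n)%C.
Proof. exact (sum_n_mult_l (K := C_Ring) x u n). Qed.

Lemma csum_bound u n B :
  (forall k, (k <= n)%nat -> Cmod (u k) <= B) -> Cmod (csum u n) <= INR (S n) * B.
Proof.
  induction n as [|n IH]; intros H.
  - rewrite csum_O. simpl. specialize (H O (le_n _)). lra.
  - rewrite csum_S, S_INR.
    eapply Rle_trans; [apply Cmod_triangle | ].
    specialize (H (S n) (le_n _)) as H1.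
    assert (H2 : Cmod (csum u n) <= INR (S n) * B) by (apply IH; auto).
    lra.
Qed.

Lemma cseries_ext u v l : (forall n, u n = v n) -> cseries u l -> cseries v l.
Proof. exact (is_series_ext (K := C_AbsRing) (V := C_NormedModule) u v l). Qed.

Lemma cseries_plus u v l m :
  cseries u l -> cseries v m -> cseries (fun n => u n + v n)%C (l + m)%C.
Proof. exact (is_series_plus (K := C_AbsRing) (V := C_NormedModule) u v l m). Qed.

Lemma cseries_scal x u l : cseries u l -> cseries (fun n => x * u n)%C (x * l)%C.
Proof. exact (is_series_scal (K := C_AbsRing) (V := C_NormedModule) x u l). Qed.

Lemma cseries_finite u n (l : C) :
  (forall k, (n < k)%nat -> u k = 0) -> csum u n = l -> cseries u l.
Proof.
  intros H <-. apply cseries_tends.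
  apply tends_ext_from with (fun _ => csum u n) n; [ | apply tends_const].
  intros m Hm. induction Hm as [|m Hm IH]; [reflexivity | ].
  rewrite csum_S, <- IH, H by lia. ring.
Qed.

(** ** Comparison with a geometric series *)

Lemma geom_bound_ge0 (u : nat -> C) B s :
  (forall k, Cmod (u k) <= B * s ^ k) -> 0 <= B.
Proof. intros HB. pose proof (HB 0%nat). pose proof (Cmod_ge_0 (u 0%nat)). simpl in *. lra. Qed.

(** A telescoping bound: the subtracted term makes the induction on [m] work. *)
Lemma geom_partial u B s n m :
  0 <= s < 1 -> (forall k, Cmod (u k) <= B * s ^ k) ->
  Cmod (csum u (n + m) - csum u n) <= B * s ^ S n / (1 - s) - B * s ^ S (n + m) / (1 - s).
Proof.
  intros Hs HB. induction m as [|m IH].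
  - rewrite Nat.add_0_r. replace (csum u n - csum u n)%C with (RtoC 0) by ring.
    rewrite Cmod_0. lra.
  - rewrite Nat.add_succ_r, csum_S.
    replace (csum u (n + m) + u (S (n + m)) - csum u n)%C
      with ((csum u (n + m) - csum u n) + u (S (n + m)))%C by ring.
    eapply Rle_trans; [apply Cmod_triangle | ].
    specialize (HB (S (n + m))).
    replace (B * s ^ S (S (n + m)) / (1 - s))
      with (B * s ^ S (n + m) / (1 - s) - B * s ^ S (n + m)) by (simpl; field; lra).
    lra.
Qed.

Lemma geom_dist u B s n m :
  0 <= s < 1 -> (forall k, Cmod (u k) <= B * s ^ k) -> (n <= m)%nat ->
  Cmod (csum u m - csum u n) <= B * s ^ S n / (1 - s).
Proof.
  intros Hs HB H. replace m with (n + (m - n))%nat by lia.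
  eapply Rle_trans; [now apply geom_partial | ].
  assert (0 <= B * s ^ S (n + (m - n)) / (1 - s)); [ | lra].
  apply Rmult_le_pos; [ | left; apply Rinv_0_lt_compat; lra].
  apply Rmult_le_pos; [exact (geom_bound_ge0 u B s HB) | apply pow_le; lra].
Qed.

Lemma geom_tail u B s l n :
  0 <= s < 1 -> (forall k, Cmod (u k) <= B * s ^ k) ->
  cseries u l -> Cmod (l - csum u n) <= B * s ^ S n / (1 - s).
Proof.
  intros Hs HB H. apply tends_ball with (csum u); [now apply cseries_tends | ].
  exists n. intros m Hm. now apply geom_dist.
Qed.

Lemma geom_sum_bound u B s l :
  0 <= s < 1 -> (forall k, Cmod (u k) <= B * s ^ k) ->
  cseries u l -> Cmod l <= B / (1 - s).
Proof.
  intros Hs HB H. pose proof (geom_tail u B s l 0%nat Hs HB H) as T. rewrite csum_O in T.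
  pose proof (HB 0%nat) as H0. simpl in T, H0.
  pose proof (Cmod_triangle (l - u 0%nat) (u 0%nat)) as T'.
  replace (l - u 0%nat + u 0%nat)%C with l in T' by ring.
  replace (B / (1 - s)) with (B * (s * 1) / (1 - s) + B * 1) by (field; lra). lra.
Qed.

Lemma pow_small B s eps :
  0 <= s < 1 -> 0 < eps -> exists N, forall n, (N <= n)%nat -> B * s ^ n < eps.
Proof.
  intros Hs He.
  destruct (pow_lt_1_zero s) with (y := eps / (Rabs B + 1)) as [N HN].
  - rewrite Rabs_pos_eq; lra.
  - apply Rdiv_lt_0_compat; [lra | ]. pose proof (Rabs_pos B). lra.
  - exists N. intros n Hn. specialize (HN n Hn).
    pose proof (Rabs_pos B). pose proof (Rle_abs B).
    assert (0 <= s ^ n) by (apply pow_le; lra).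
    rewrite Rabs_pos_eq in HN by assumption.
    assert (E : (Rabs B + 1) * (eps / (Rabs B + 1)) = eps) by (field; lra). nra.
Qed.

Lemma geom_cvg u B s :
  0 <= s < 1 -> (forall k, Cmod (u k) <= B * s ^ k) -> exists l, cseries u l.
Proof.
  intros Hs HB.
  destruct (tends_cauchy (csum u)) as [l Hl].
  - intros eps He.
    destruct (pow_small (B / (1 - s)) s (eps / 2) Hs ltac:(lra)) as [N HN].
    exists N.
    assert (H : forall m, (N <= m)%nat -> Cmod (csum u m - csum u N) < eps / 2).
    { intros m Hm. eapply Rle_lt_trans; [now apply geom_dist with (B := B) (s := s) | ].
      specialize (HN (S N) ltac:(lia)).
      replace (B * s ^ S N / (1 - s)) with (B / (1 - s) * s ^ S N) by (field; lra). lra. }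
    intros n m Hn Hm.
    pose proof (Cmod_triangle3 (csum u n) (csum u N) (csum u m)) as T.
    rewrite (Cmod_minus_sym (csum u N)) in T.
    specialize (H n Hn) as H1. specialize (H m Hm) as H2. lra.
  - exists l. now apply cseries_tends.
Qed.

Lemma cseries_terms_bounded u l : cseries u l -> exists B, forall k, Cmod (u k) <= B.
Proof.
  intros H. apply cseries_tends in H.
  destruct (H 1 Rlt_0_1) as [N HN].
  assert (E : forall n, exists B, forall k, (k <= n)%nat -> Cmod (u k) <= B).
  { induction n as [|n [B HB]].
    - exists (Cmod (u 0%nat)). intros k Hk. replace k with 0%nat by lia. lra.
    - exists (Rmax B (Cmod (u (S n)))). intros k Hk.
      destruct (Nat.eq_dec k (S n)) as [-> | Hne]; [apply Rmax_r | ].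
      eapply Rle_trans; [apply HB; lia | apply Rmax_l]. }
  destruct (E N) as [B HB].
  exists (Rmax B 2). intros k.
  destruct (le_lt_dec k N) as [Hk | Hk].
  - eapply Rle_trans; [now apply HB | apply Rmax_l].
  - eapply Rle_trans; [ | apply Rmax_r].
    destruct k as [|k]; [lia | ].
    replace (u (S k)) with ((csum u (S k) - l) - (csum u k - l))%C
      by (rewrite csum_S; ring).
    eapply Rle_trans; [apply Cmod_minus_le | ].
    specialize (HN k ltac:(lia)) as H1. specialize (HN (S k) ltac:(lia)) as H2. lra.
Qed.

(** ** Cauchy products *)

Lemma Re_csum u n : Re (csum u n) = sum_n (fun k => Re (u k)) n.
Proof.
  induction n as [|n IH]; [now rewrite csum_O, sum_O | ].
  rewrite csum_S, sum_Sn, <- IH. reflexivity.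
Qed.

Lemma Im_csum u n : Im (csum u n) = sum_n (fun k => Im (u k)) n.
Proof.
  induction n as [|n IH]; [now rewrite csum_O, sum_O | ].
  rewrite csum_S, sum_Sn, <- IH. reflexivity.
Qed.

Lemma Rabs_Im_le (z : C) : Rabs (Im z) <= Cmod z.
Proof. eapply Rle_trans; [apply Rmax_r | apply Rmax_Cmod]. Qed.

Lemma Cmod_le_Re_Im (z : C) : Cmod z <= Rabs (Re z) + Rabs (Im z).
Proof.
  replace z with (RtoC (Re z) + Ci * RtoC (Im z))%C at 1
    by (destruct z; unfold Re, Im, Ci, RtoC, Cplus, Cmult; simpl; f_equal; ring).
  eapply Rle_trans; [apply Cmod_triangle | ].
  rewrite Cmod_mult, Cmod_Ci, !Cmod_R. lra.
Qed.

Lemma cseries_Re_Im u (l : C) :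
  cseries u l <->
  is_series (fun k => Re (u k)) (Re l) /\ is_series (fun k => Im (u k)) (Im l).
Proof.
  rewrite cseries_tends. split.
  - intros H. split; apply filterlim_locally; intros eps;
      destruct (H eps (cond_pos eps)) as [N HN]; exists N; intros n Hn;
      specialize (HN n Hn); eapply Rle_lt_trans; try exact HN.
    + rewrite <- Re_csum. exact (re_le_Cmod (csum u n - l)).
    + rewrite <- Im_csum. exact (Rabs_Im_le (csum u n - l)).
  - intros [HR HI] eps He.
    assert (He2 : 0 < eps / 2) by lra.
    destruct (proj1 (filterlim_locally _ _) HR (mkposreal _ He2)) as [N HN].
    destruct (proj1 (filterlim_locally _ _) HI (mkposreal _ He2)) as [N' HN'].
    exists (max N N'). intros n Hn.
    specialize (HN n ltac:(lia)). specialize (HN' n ltac:(lia)).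
    rewrite <- Re_csum in HN. rewrite <- Im_csum in HN'.
    change (Rabs (Re (csum u n) - Re l) < eps / 2) in HN.
    change (Rabs (Im (csum u n) - Im l) < eps / 2) in HN'.
    eapply Rle_lt_trans; [apply Cmod_le_Re_Im | ].
    change (Rabs (Re (csum u n) - Re l) + Rabs (Im (csum u n) - Im l) < eps). lra.
Qed.

Definition conv u v (n : nat) : C := csum (fun k => u k * v (n - k)%nat)%C n.

Lemma ex_series_geom_bound (x : nat -> R) B s :
  0 <= s < 1 -> (forall k, Rabs (x k) <= B * s ^ k) -> ex_series (fun k => Rabs (x k)).
Proof.
  intros Hs H. apply (ex_series_le (K := R_AbsRing) (V := R_CompleteNormedModule))
    with (fun k => B * s ^ k).
  - intros n. change (Rabs (Rabs (x n)) <= B * s ^ n). now rewrite Rabs_Rabsolu.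
  - apply (ex_series_scal (K := R_AbsRing) (V := R_NormedModule)).
    apply ex_series_geom. rewrite Rabs_pos_eq; lra.
Qed.

(** The Cauchy product theorem for complex series, from the real one applied to
    the four products of real and imaginary parts. *)
Lemma cseries_conv u v (l m : C) B s B' s' :
  0 <= s < 1 -> (forall k, Cmod (u k) <= B * s ^ k) ->
  0 <= s' < 1 -> (forall k, Cmod (v k) <= B' * s' ^ k) ->
  cseries u l -> cseries v m -> cseries (conv u v) (l * m)%C.
Proof.
  intros Hs Hu Hs' Hv Hl Hm.
  apply cseries_Re_Im in Hl. destruct Hl as [HlR HlI].
  apply cseries_Re_Im in Hm. destruct Hm as [HmR HmI].
  assert (AuR := ex_series_geom_bound (fun k => Re (u k)) B s Hs
    (fun k => Rle_trans _ _ _ (re_le_Cmod _) (Hu k))).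
  assert (AuI := ex_series_geom_bound (fun k => Im (u k)) B s Hs
    (fun k => Rle_trans _ _ _ (Rabs_Im_le _) (Hu k))).
  assert (AvR := ex_series_geom_bound (fun k => Re (v k)) B' s' Hs'
    (fun k => Rle_trans _ _ _ (re_le_Cmod _) (Hv k))).
  assert (AvI := ex_series_geom_bound (fun k => Im (v k)) B' s' Hs'
    (fun k => Rle_trans _ _ _ (Rabs_Im_le _) (Hv k))).
  pose proof (is_series_mult _ _ _ _ HlR HmR AuR AvR) as RR.
  pose proof (is_series_mult _ _ _ _ HlI HmI AuI AvI) as II.
  pose proof (is_series_mult _ _ _ _ HlR HmI AuR AvI) as RI.
  pose proof (is_series_mult _ _ _ _ HlI HmR AuI AvR) as IR.
  apply cseries_Re_Im. split.
  - pose proof (is_series_minus _ _ _ _ RR II) as H.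
    eapply is_series_ext; [ | exact H].
    intros n. unfold conv. rewrite Re_csum, sum_n_Reals.
    symmetry. rewrite (sum_eq _ (fun k => Re (u k) * Re (v (n - k)%nat)
      - Im (u k) * Im (v (n - k)%nat)) n) by (intros; reflexivity).
    rewrite minus_sum. reflexivity.
  - pose proof (is_series_plus _ _ _ _ RI IR) as H.
    eapply is_series_ext; [ | exact H].
    intros n. unfold conv. rewrite Im_csum, sum_n_Reals.
    symmetry. rewrite (sum_eq _ (fun k => Re (u k) * Im (v (n - k)%nat)
      + Im (u k) * Re (v (n - k)%nat)) n) by (intros; reflexivity).
    rewrite sum_plus. reflexivity.
Qed.

(** * Functions given by a power series in a disk *)

(** The representing disk is centred at 0: a function near [z0] is studied through
    [fun w => p (z0 + w)], and its center never has to move. *)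
Definition expands (c : nat -> C) (R : R) (p : C -> C) : Prop :=
  forall w : C, Cmod w < R -> cseries (fun k => c k * w ^ k)%C (p w).

Definition ana (R : R) (p : C -> C) : Prop := exists c, expands c R p.

Lemma pow_n_Cpow (z : C) n : pow_n (K := C_Ring) z n = (z ^ n)%C.
Proof. induction n as [|n IH]; [reflexivity | ]. simpl. now rewrite IH. Qed.

Lemma is_pseries_cseries (c : nat -> C) (z l : C) :
  is_pseries (K := C_AbsRing) (V := C_NormedModule) c z l <->
  cseries (fun k => c k * z ^ k)%C l.
Proof.
  unfold is_pseries.
  assert (E : forall k, scal (K := C_AbsRing) (V := C_NormedModule)
                (pow_n (K := C_AbsRing) z k) (c k) = (c k * z ^ k)%C).
  { intros k. change (pow_n (K := C_Ring) z k * c k = c k * z ^ k)%C.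
    rewrite pow_n_Cpow. ring. }
  split; intros H.
  - apply cseries_ext with (2 := H). exact E.
  - eapply cseries_ext with (2 := H). intros k. symmetry. apply E.
Qed.

Lemma ana_analytic_at (f : C -> C) z0 R p :
  0 < R -> ana R p -> (forall w, Cmod w < R -> f (z0 + w)%C = p w) -> analytic_at f z0.
Proof.
  intros HR [c Hc] E. exists c, R. split; [exact HR | ].
  intros z Hz. apply (proj2 (is_pseries_cseries c (z - z0)%C (f z))).
  replace (f z) with (p (z - z0)%C); [now apply Hc | ].
  rewrite <- E by exact Hz. f_equal. ring.
Qed.

Lemma analytic_at_ana (f : C -> C) z0 :
  analytic_at f z0 -> exists R, 0 < R /\ ana R (fun w => f (z0 + w)%C).
Proof.
  intros [c [r [Hr H]]]. exists r. split; [exact Hr | ].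
  exists c. intros w Hw. apply (proj1 (is_pseries_cseries c w (f (z0 + w)%C))).
  replace w with (z0 + w - z0)%C at 1 by ring. apply H.
  now replace (z0 + w - z0)%C with w by ring.
Qed.

Lemma ana_ext R p q : (forall w, Cmod w < R -> p w = q w) -> ana R p -> ana R q.
Proof. intros E [c H]. exists c. intros w Hw. rewrite <- E by exact Hw. auto. Qed.

Lemma ana_le R R' p : R' <= R -> ana R p -> ana R' p.
Proof. intros HR [c H]. exists c. intros w Hw. apply H. lra. Qed.

(** The terms of the convergent series at the real point [r] are bounded. *)
Lemma expands_coef_bound c R p r :
  expands c R p -> 0 <= r < R -> exists B, forall k, Cmod (c k) * r ^ k <= B.
Proof.
  intros H Hr.
  assert (Er : Cmod r = r) by (rewrite Cmod_R; apply Rabs_pos_eq; lra).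
  destruct (cseries_terms_bounded _ _ (H (RtoC r) ltac:(lra))) as [B HB].
  exists B. intros k. specialize (HB k).
  now rewrite Cmod_mult, Cmod_pow, Er in HB.
Qed.

Lemma coef_geom (c : C) (w : C) r B k :
  0 < r -> Cmod c * r ^ k <= B -> Cmod (c * w ^ k) <= B * (Cmod w / r) ^ k.
Proof.
  intros Hr H. rewrite Cmod_mult, Cmod_pow.
  unfold Rdiv. rewrite Rpow_mult_distr, pow_inv.
  assert (0 < r ^ k) by now apply pow_lt.
  assert (0 <= Cmod w ^ k) by (apply pow_le, Cmod_ge_0).
  replace (Cmod c * Cmod w ^ k) with ((Cmod c * r ^ k) * (Cmod w ^ k * / r ^ k))
    by (field; lra).
  apply Rmult_le_compat_r; [ | exact H].
  apply Rmult_le_pos; [assumption | left; now apply Rinv_0_lt_compat].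
Qed.

Lemma ratio_lt_1 x r : 0 <= x -> x < r -> 0 <= x / r < 1.
Proof.
  intros H0 H. split.
  - apply Rmult_le_pos; [exact H0 | left; apply Rinv_0_lt_compat; lra].
  - apply Rmult_lt_reg_r with r; [lra | ].
    replace (x / r * r) with x by (field; lra). lra.
Qed.

(** Inside its disk of convergence a power series is dominated by a geometric
    one: compare with a slightly larger radius. *)
Lemma expands_geom c R p rho :
  expands c R p -> 0 <= rho < R ->
  exists B s, 0 <= s < 1 /\
    forall w, Cmod w <= rho -> forall k, Cmod (c k * w ^ k) <= B * s ^ k.
Proof.
  intros H Hrho.
  destruct (expands_coef_bound c R p ((rho + R) / 2) H ltac:(lra)) as [B HB].
  exists B, (rho / ((rho + R) / 2)).
  assert (Hs := ratio_lt_1 rho ((rho + R) / 2) ltac:(lra) ltac:(lra)).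
  split; [exact Hs | ]. intros w Hw k.
  eapply Rle_trans; [apply coef_geom with (r := (rho + R) / 2) (B := B); [lra | apply HB] | ].
  apply Rmult_le_compat_l.
  - eapply Rle_trans; [ | apply (HB 0%nat)]. simpl. pose proof (Cmod_ge_0 (c 0%nat)). lra.
  - apply pow_incr. split.
    + apply Rmult_le_pos; [apply Cmod_ge_0 | left; apply Rinv_0_lt_compat; lra].
    + apply Rmult_le_compat_r; [left; apply Rinv_0_lt_compat; lra | exact Hw].
Qed.

Lemma ana_const R x : ana R (fun _ => x).
Proof.
  exists (fun k => match k with O => x | _ => RtoC 0 end). intros w _.
  apply cseries_finite with 0%nat.
  - intros [|k] Hk; [lia | ring].
  - rewrite csum_O. simpl. ring.
Qed.

Lemma ana_id R : ana R (fun w => w).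
Proof.
  exists (fun k => match k with 1%nat => RtoC 1 | _ => RtoC 0 end). intros w _.
  apply cseries_finite with 1%nat.
  - intros [|[|k]] Hk; [lia | lia | ring].
  - rewrite csum_S, csum_O. simpl. ring.
Qed.

Lemma ana_plus R p q : ana R p -> ana R q -> ana R (fun w => p w + q w)%C.
Proof.
  intros [c Hc] [d Hd]. exists (fun k => c k + d k)%C. intros w Hw.
  eapply cseries_ext; [ | exact (cseries_plus _ _ _ _ (Hc w Hw) (Hd w Hw))].
  intros k. simpl. ring.
Qed.

Lemma ana_mult R p q : ana R p -> ana R q -> ana R (fun w => p w * q w)%C.
Proof.
  intros [c Hc] [d Hd]. exists (conv c d). intros w Hw.
  assert (Hw' : 0 <= Cmod w < R) by (split; [apply Cmod_ge_0 | exact Hw]).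
  destruct (expands_geom c R p (Cmod w) Hc Hw') as [B [s [Hs HB]]].
  destruct (expands_geom d R q (Cmod w) Hd Hw') as [B' [s' [Hs' HB']]].
  eapply cseries_ext; [ | exact (cseries_conv _ _ _ _ B s B' s' Hs (HB w (Rle_refl _))
     Hs' (HB' w (Rle_refl _)) (Hc w Hw) (Hd w Hw))].
  intros n. unfold conv. rewrite Cmult_comm, <- csum_scal.
  apply csum_ext. intros k Hk.
  replace (w ^ n)%C with (w ^ k * w ^ (n - k))%C
    by (rewrite <- Cpow_add_r; f_equal; lia).
  ring.
Qed.

Lemma cseries_minus u v (l m : C) :
  cseries u l -> cseries v m -> cseries (fun n => u n - v n)%C (l - m)%C.
Proof. exact (is_series_minus (K := C_AbsRing) (V := C_NormedModule) u v l m). Qed.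

Lemma expands_minus c d R p q :
  expands c R p -> expands d R q ->
  expands (fun k => c k - d k)%C R (fun w => p w - q w)%C.
Proof.
  intros Hc Hd w Hw.
  eapply cseries_ext; [ | exact (cseries_minus _ _ _ _ (Hc w Hw) (Hd w Hw))].
  intros k. simpl. ring.
Qed.

Lemma ana_minus R p q : ana R p -> ana R q -> ana R (fun w => p w - q w)%C.
Proof. intros [c Hc] [d Hd]. eexists. exact (expands_minus _ _ _ _ _ Hc Hd). Qed.

Lemma ana_pow R p n : ana R p -> ana R (fun w => p w ^ n)%C.
Proof.
  intros H. induction n as [|n IH]; simpl; [apply ana_const | now apply ana_mult].
Qed.

Lemma ana_csum R (p : nat -> C -> C) n :
  (forall k, ana R (p k)) -> ana R (fun w => csum (fun k => p k w) n).
Proof.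
  intros H. induction n as [|n IH].
  - eapply ana_ext; [ | apply (H 0%nat)]. intros w _. now rewrite csum_O.
  - eapply ana_ext; [ | exact (ana_plus _ _ _ IH (H (S n)))].
    intros w _. now rewrite csum_S.
Qed.

Lemma csum_geom (y : C) n : y <> 1 ->
  csum (fun k => y ^ k)%C n = (/ (1 - y) - / (1 - y) * y ^ S n)%C.
Proof.
  intros Hy.
  assert (N1 : (1 - y)%C <> 0).
  { intros E. apply Hy. replace y with (1 - (1 - y))%C by ring. rewrite E. ring. }
  induction n as [|n IH].
  - rewrite csum_O. simpl. field. exact N1.
  - rewrite csum_S, IH. simpl. field. exact N1.
Qed.

Lemma cseries_geom (y : C) : Cmod y < 1 -> cseries (fun k => y ^ k)%C (/ (1 - y))%C.
Proof.
  intros Hy.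
  assert (Ny : y <> 1) by (intros ->; rewrite Cmod_1 in Hy; lra).
  assert (Hs : 0 <= Cmod y < 1) by (split; [apply Cmod_ge_0 | exact Hy]).
  apply cseries_tends. intros eps He.
  destruct (pow_small (Cmod (/ (1 - y))) (Cmod y) eps Hs He) as [N HN].
  exists N. intros n Hn. rewrite (csum_geom y n Ny).
  replace (/ (1 - y) - / (1 - y) * y ^ S n - / (1 - y))%C
    with (- (/ (1 - y) * y ^ S n))%C by ring.
  rewrite Cmod_opp, Cmod_mult, Cmod_pow. apply HN. lia.
Qed.

Lemma ana_inv R x : 0 < R -> R <= Cmod x -> ana R (fun w => / (x + w))%C.
Proof.
  intros HR Hx.
  assert (Nx : x <> 0) by (apply Cmod_gt_0; lra).
  exists (fun k => / x * (- / x) ^ k)%C. intros w Hw.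
  assert (Hy : Cmod (- / x * w) < 1).
  { rewrite Cmod_mult, Cmod_opp, Cmod_inv by exact Nx.
    rewrite Rmult_comm. apply ratio_lt_1; [apply Cmod_ge_0 | lra]. }
  assert (Nxw : (x + w)%C <> 0).
  { intros E. replace x with (x + w - w)%C in Hx by ring. rewrite E in Hx.
    replace (0 - w)%C with (- w)%C in Hx by ring. rewrite Cmod_opp in Hx. lra. }
  replace (/ (x + w))%C with (/ x * / (1 - - / x * w))%C.
  - eapply cseries_ext; [ | exact (cseries_scal (/ x)%C _ _ (cseries_geom _ Hy))].
    intros k. simpl. rewrite Cpow_mult_l. ring.
  - field. repeat split; auto.
Qed.

(** * The Cauchy estimate and uniform limits *)

Definition cis (t : R) : C := (cos t, sin t).

Lemma cis_plus s t : cis (s + t) = (cis s * cis t)%C.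
Proof. unfold cis, Cmult. simpl. rewrite cos_plus, sin_plus. f_equal; ring. Qed.

Lemma cis_0 : cis 0 = 1.
Proof. unfold cis. now rewrite cos_0, sin_0. Qed.

Lemma cis_INR t n : cis (INR n * t) = (cis t ^ n)%C.
Proof.
  induction n as [|n IH]; [simpl; now rewrite Rmult_0_l, cis_0 | ].
  rewrite S_INR, Cpow_S, <- IH, <- cis_plus. f_equal. ring.
Qed.

Lemma Cmod_cis t : Cmod (cis t) = 1.
Proof.
  unfold Cmod, cis. simpl. rewrite !Rmult_1_r.
  replace (cos t * cos t + sin t * sin t) with 1; [apply sqrt_1 | ].
  pose proof (sin2_cos2 t) as H. unfold Rsqr in H. lra.
Qed.

Lemma cis_neq_1 t : 0 < Rabs t < 2 * PI -> cis t <> 1.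
Proof.
  intros Ht E. injection E as Ec _.
  replace t with (2 * (t / 2)) in Ec by field. rewrite cos_2a_sin in Ec.
  assert (S0 : sin (t / 2) = 0) by nra.
  destruct (Rcase_abs t) as [Hn | Hp].
  - rewrite Rabs_left in Ht by lra.
    assert (0 < sin (- (t / 2))) by (apply sin_gt_0; lra). rewrite sin_neg in H. lra.
  - rewrite Rabs_right in Ht by lra.
    assert (0 < sin (t / 2)) by (apply sin_gt_0; lra). lra.
Qed.

Lemma cis_2PI_INR n : cis (INR n * (2 * PI)) = 1.
Proof.
  rewrite cis_INR. replace (cis (2 * PI)) with (RtoC 1); [apply Cpow_1_l | ].
  unfold cis. now rewrite cos_2PI, sin_2PI.
Qed.

(** Orthogonality of the characters of the cyclic group of order [n + 1]. *)
Lemma cis_orthogonality n m k : (m <= n)%nat -> (k <= n)%nat -> m <> k ->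
  csum (fun j => cis (INR j * ((INR m - INR k) * (2 * PI / INR (S n))))) n = 0.
Proof.
  intros Hm Hk Hmk.
  assert (Hn : 0 < INR (S n)) by (apply lt_0_INR; lia).
  pose proof PI_RGT_0 as HPI.
  set (t := (INR m - INR k) * (2 * PI / INR (S n))).
  assert (N1 : cis t <> 1).
  { apply cis_neq_1. unfold t. rewrite Rabs_mult.
    rewrite (Rabs_pos_eq (2 * PI / INR (S n))) by (apply Rlt_le, Rdiv_lt_0_compat; lra).
    assert (H0 : 0 < Rabs (INR m - INR k)).
    { apply Rabs_pos_lt. intros E. apply Hmk, INR_eq. lra. }
    assert (H1 : Rabs (INR m - INR k) < INR (S n)).
    { assert (Hm' : INR m < INR (S n)) by (apply lt_INR; lia).
      assert (Hk' : INR k < INR (S n)) by (apply lt_INR; lia).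
      pose proof (pos_INR m). pose proof (pos_INR k). apply Rabs_def1; lra. }
    assert (H2 : 0 < 2 * PI / INR (S n)) by (apply Rdiv_lt_0_compat; lra).
    split; [nra | ].
    replace (2 * PI) with (INR (S n) * (2 * PI / INR (S n))) at 2 by (field; lra).
    nra. }
  assert (P1 : (cis t ^ S n)%C = 1).
  { rewrite <- cis_INR. unfold t.
    replace (INR (S n) * ((INR m - INR k) * (2 * PI / INR (S n))))
      with (INR m * (2 * PI) + INR k * (- (2 * PI))) by (field; lra).
    rewrite cis_plus, cis_2PI_INR, cis_INR.
    replace (cis (- (2 * PI))) with (RtoC 1).
    - rewrite Cpow_1_l. ring.
    - unfold cis. now rewrite cos_neg, sin_neg, cos_2PI, sin_2PI, Ropp_0. }
  rewrite (csum_ext _ (fun j => cis t ^ j)%C) by (intros; apply cis_INR).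
  rewrite csum_geom by exact N1. rewrite P1. ring.
Qed.

Lemma csum_0 n : csum (fun _ => RtoC 0) n = 0.
Proof. induction n as [|n IH]; [apply csum_O | ]. rewrite csum_S, IH. ring. Qed.

Lemma csum_single u n k :
  (k <= n)%nat -> (forall m, (m <= n)%nat -> m <> k -> u m = 0) -> csum u n = u k.
Proof.
  induction n as [|n IH]; intros Hk H.
  - replace k with O by lia. apply csum_O.
  - rewrite csum_S. destruct (Nat.eq_dec k (S n)) as [-> | Hne].
    + rewrite (csum_ext _ (fun _ => RtoC 0)) by (intros; apply H; lia).
      rewrite csum_0. ring.
    + rewrite IH, (H (S n)); [ring | lia | lia | lia | ].
      intros m Hm Hmk. apply H; lia.
Qed.

(** Averaging [p (w) * (rho / w) ^ k] over the vertices [w] of a regular polygon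
    with [n + 1] vertices recovers [c k * rho ^ k] up to the error made in
    truncating the series after the index [n], by orthogonality of characters. *)
Lemma cauchy_estimate c R p rho B :
  expands c R p -> 0 < rho < R -> (forall w, Cmod w = rho -> Cmod (p w) <= B) ->
  forall k, Cmod (c k) * rho ^ k <= B.
Proof.
  intros Hp Hrho HB k.
  destruct (expands_geom c R p rho Hp ltac:(lra)) as [B1 [s [Hs HB1]]].
  apply le_epsilon. intros eps He.
  destruct (pow_small (B1 / (1 - s)) s eps Hs He) as [N HN].
  (* Beyond [N] the truncation error is below [eps]; [n >= k] keeps the index [k]
     in the truncated sum. *)
  set (n := max N k).
  assert (Hn : 0 < INR (S n)) by (apply lt_0_INR; lia).
  set (t := 2 * PI / INR (S n)).
  set (w := fun j => (RtoC rho * cis (INR j * t))%C).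
  assert (Er : Cmod rho = rho) by (rewrite Cmod_R; apply Rabs_pos_eq; lra).
  assert (Ew : forall j, Cmod (w j) = rho).
  { intros j. unfold w. rewrite Cmod_mult, Cmod_cis, Er. ring. }
  assert (Hj : forall j, Cmod (csum (fun m => c m * w j ^ m)%C n * cis (INR j * (- INR k * t)))
                         <= B + eps).
  { intros j. rewrite Cmod_mult, Cmod_cis, Rmult_1_r.
    assert (T := geom_tail _ B1 s _ n Hs (HB1 (w j) (Req_le _ _ (Ew j)))
                   (Hp (w j) ltac:(rewrite Ew; lra))).
    specialize (HB (w j) (Ew j)).
    specialize (HN (S n) ltac:(lia)).
    replace (B1 * s ^ S n / (1 - s)) with (B1 / (1 - s) * s ^ S n) in T by (field; lra).
    replace (csum (fun m => c m * w j ^ m)%C n)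
      with (p (w j) - (p (w j) - csum (fun m => c m * w j ^ m)%C n))%C by ring.
    eapply Rle_trans; [apply Cmod_minus_le | ]. lra. }
  assert (E : csum (fun j => csum (fun m => c m * w j ^ m)%C n * cis (INR j * (- INR k * t)))%C n
              = (RtoC (INR (S n)) * (c k * RtoC rho ^ k))%C).
  { transitivity (csum (fun j => csum (fun m =>
        c m * RtoC rho ^ m * cis (INR j * ((INR m - INR k) * t))) n)%C n).
    { apply csum_ext. intros j _. rewrite Cmult_comm, <- csum_scal.
      apply csum_ext. intros m _. unfold w. rewrite Cpow_mult_l, <- cis_INR.
      replace (INR j * ((INR m - INR k) * t))
        with (INR m * (INR j * t) + INR j * (- INR k * t)) by ring.
      rewrite cis_plus. ring. }
    unfold csum at 1 2.
    rewrite (sum_n_switch (G := C_AbelianMonoid)). fold (csum).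
    change (csum (fun m => csum (fun j => c m * RtoC rho ^ m *
              cis (INR j * ((INR m - INR k) * t)))%C n) n
            = (RtoC (INR (S n)) * (c k * RtoC rho ^ k))%C).
    rewrite (csum_single _ n k).
    - rewrite csum_scal.
      rewrite (csum_ext _ (fun _ => RtoC 1)).
      + replace (csum (fun _ => RtoC 1) n) with (RtoC (INR (S n))); [ring | ].
        clear. induction n as [|n IH]; [now rewrite csum_O | ].
        rewrite csum_S, <- IH, S_INR, RtoC_plus. reflexivity.
      + intros j _. replace (INR j * ((INR k - INR k) * t)) with 0 by ring. apply cis_0.
    - unfold n. lia.
    - intros m Hm Hmk. rewrite csum_scal.
      unfold t. rewrite cis_orthogonality by (try exact Hmk; unfold n in *; lia). ring. }
  pose proof (csum_bound _ n (B + eps) (fun j _ => Hj j)) as Hb.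
  rewrite E, !Cmod_mult, Cmod_pow, Er, Cmod_R, Rabs_pos_eq in Hb by lra.
  now apply Rmult_le_reg_l in Hb.
Qed.

(** Uniform convergence on a circle of functions given by power series: the
    Cauchy estimate applied to differences makes every sequence of Taylor
    coefficients a Cauchy sequence, and the limits are the coefficients of a
    power series for the limit inside the circle. *)
Lemma circle_limit_ana R rho (p : nat -> C -> C) (phi : C -> C) :
  0 < rho < R -> (forall j, ana R (p j)) ->
  (forall eps, 0 < eps -> exists N, forall j, (N <= j)%nat ->
     forall w, Cmod w = rho -> Cmod (p j w - phi w) <= eps) ->
  exists q, ana rho q /\ forall w, Cmod w < rho -> tends (fun j => p j w) (q w).
Proof.
  intros Hrho Hp Hu.
  set (c := fun j => proj1_sig (constructive_indefinite_description _ (Hp j))).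
  assert (Hc : forall j, expands (c j) R (p j)).
  { intros j. unfold c. now destruct (constructive_indefinite_description _ (Hp j)). }
  assert (Cau : forall eps, 0 < eps -> exists N, forall i j, (N <= i)%nat -> (N <= j)%nat ->
            forall k, Cmod (c i k - c j k) * rho ^ k <= eps).
  { intros eps He. destruct (Hu (eps / 2) ltac:(lra)) as [N HN].
    exists N. intros i j Hi Hj.
    apply (cauchy_estimate (fun k => c i k - c j k)%C R (fun w => p i w - p j w)%C);
      [ | exact Hrho | ].
    - now apply expands_minus.
    - intros w Hw. specialize (HN i Hi w Hw) as H1. specialize (HN j Hj w Hw) as H2.
      pose proof (Cmod_triangle3 (p i w) (phi w) (p j w)) as T.
      rewrite (Cmod_minus_sym (phi w)) in T. lra. }
  assert (Hpow : forall k, 0 < rho ^ k) by (intros k; apply pow_lt; lra).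
  assert (Lim : forall k, exists l, tends (fun j => c j k) l).
  { intros k. apply tends_cauchy. intros eps He.
    specialize (Hpow k).
    destruct (Cau (eps / 2 * rho ^ k)) as [N HN]; [apply Rmult_lt_0_compat; lra | ].
    exists N. intros i j Hi Hj. specialize (HN i j Hi Hj k).
    apply Rmult_le_reg_r in HN; lra. }
  set (d := fun k => proj1_sig (constructive_indefinite_description _ (Lim k))).
  assert (Hd : forall k, tends (fun j => c j k) (d k)).
  { intros k. unfold d. now destruct (constructive_indefinite_description _ (Lim k)). }
  assert (Unif : forall eps, 0 < eps -> exists N, forall i, (N <= i)%nat ->
            forall k, Cmod (c i k - d k) * rho ^ k <= eps).
  { intros eps He. destruct (Cau eps He) as [N HN]. exists N. intros i Hi k.
    apply Rmult_le_reg_r with (/ rho ^ k); [now apply Rinv_0_lt_compat | ].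
    specialize (Hpow k).
    rewrite Rmult_assoc, Rinv_r, Rmult_1_r by lra.
    rewrite Cmod_minus_sym. apply (tends_ball _ _ _ _ (Hd k)).
    exists N. intros j Hj.
    apply Rmult_le_reg_r with (rho ^ k); [assumption | ].
    rewrite Rmult_assoc, Rinv_l, Rmult_1_r by lra. now apply HN. }
  exists (fun w => CSeries (fun k => d k * w ^ k)%C).
  assert (Hq : expands d rho (fun w => CSeries (fun k => d k * w ^ k)%C)).
  { destruct (Unif 1 Rlt_0_1) as [N HN].
    destruct (expands_coef_bound (c N) R (p N) rho (Hc N) ltac:(lra)) as [B HB].
    intros w Hw.
    destruct (geom_cvg (fun k => d k * w ^ k)%C (B + 1) (Cmod w / rho)) as [l Hl].
    - apply ratio_lt_1; [apply Cmod_ge_0 | exact Hw].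
    - intros k. apply coef_geom; [lra | ].
      specialize (HB k). specialize (HN N (le_n _) k). specialize (Hpow k).
      assert (T : Cmod (d k) <= Cmod (c N k) + Cmod (c N k - d k)).
      { replace (d k) with (c N k - (c N k - d k))%C at 1 by ring. apply Cmod_minus_le. }
      nra.
    - now rewrite (CSeries_eq _ _ Hl). }
  split; [now exists d | ].
  intros w Hw eps He.
  assert (Hs := ratio_lt_1 _ _ (Cmod_ge_0 w) Hw).
  set (s := Cmod w / rho) in *.
  destruct (Unif (eps / 2 * (1 - s))) as [N HN]; [apply Rmult_lt_0_compat; lra | ].
  exists N. intros j Hj.
  apply Rle_lt_trans with (eps / 2 * (1 - s) / (1 - s)).
  - apply (geom_sum_bound (fun k => (c j k - d k) * w ^ k)%C); [exact Hs | | ].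
    + intros k. apply coef_geom; [lra | now apply HN].
    + assert (Hcj : expands (c j) rho (p j)) by (intros w' Hw'; apply Hc; lra).
      exact (expands_minus _ _ _ _ _ Hcj Hq w Hw).
  - replace (eps / 2 * (1 - s) / (1 - s)) with (eps / 2) by (field; lra). lra.
Qed.

(** * Convergence of the coefficients of bounded power series *)

(** The tail is uniformly small because the coefficients are bounded, and only
    finitely many coefficients enter the remaining part. *)
Lemma bounded_coef_limit (u : nat -> nat -> C) (b : nat -> C) M s :
  0 <= s < 1 -> (forall j k, Cmod (u j k) <= M) -> (forall k, Cmod (b k) <= M) ->
  (forall k, tends (fun j => u j k) (b k)) ->
  forall eps, 0 < eps -> exists N, forall j, (N <= j)%nat ->
    forall y l m, Cmod y <= s ->
      cseries (fun k => u j k * y ^ k)%C l -> cseries (fun k => b k * y ^ k)%C m ->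
      Cmod (l - m) <= eps.
Proof.
  intros Hs Hu Hb Hlim eps He.
  destruct (pow_small (2 * M / (1 - s)) s (eps / 2) Hs ltac:(lra)) as [n Hn].
  specialize (Hn (S n) ltac:(lia)).
  assert (Hpos : 0 < INR (S n)) by (apply lt_0_INR; lia).
  assert (Hfin : forall n', exists N, forall j, (N <= j)%nat -> forall k, (k <= n')%nat ->
            Cmod (u j k - b k) <= eps / 2 / INR (S n)).
  { assert (He2 : 0 < eps / 2 / INR (S n)) by (apply Rdiv_lt_0_compat; lra).
    induction n' as [|n' [N HN]].
    - destruct (Hlim O _ He2) as [N HN]. exists N. intros j Hj k Hk.
      replace k with O by lia. now apply Rlt_le, HN.
    - destruct (Hlim (S n') _ He2) as [N' HN']. exists (max N N'). intros j Hj k Hk.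
      destruct (Nat.eq_dec k (S n')) as [-> | Hne].
      + apply Rlt_le, HN'. lia.
      + apply HN; lia. }
  destruct (Hfin n) as [N HN]. exists N. intros j Hj y l m Hy Hl Hm.
  assert (Hyk : forall k, 0 <= Cmod y ^ k <= s ^ k).
  { intros k. split; [apply pow_le, Cmod_ge_0 | ].
    apply pow_incr. split; [apply Cmod_ge_0 | exact Hy]. }
  assert (Hsk : forall k, s ^ k <= 1).
  { intros k. rewrite <- (pow1 k). apply pow_incr. lra. }
  pose proof (cseries_minus _ _ _ _ Hl Hm) as Hlm.
  assert (Hterm : forall k, Cmod (u j k * y ^ k - b k * y ^ k) <= 2 * M * s ^ k).
  { intros k.
    replace (u j k * y ^ k - b k * y ^ k)%C with ((u j k - b k) * y ^ k)%C by ring.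
    rewrite Cmod_mult, Cmod_pow.
    specialize (Hyk k). specialize (Hu j k). specialize (Hb k).
    pose proof (Cmod_minus_le (u j k) (b k)). pose proof (Cmod_ge_0 (u j k - b k)). nra. }
  assert (T := geom_tail _ (2 * M) s _ n Hs Hterm Hlm).
  replace (2 * M * s ^ S n / (1 - s)) with (2 * M / (1 - s) * s ^ S n) in T by (field; lra).
  assert (F : Cmod (csum (fun k => u j k * y ^ k - b k * y ^ k)%C n) <= eps / 2).
  { replace (eps / 2) with (INR (S n) * (eps / 2 / INR (S n))) by (field; lra).
    apply csum_bound. intros k Hk.
    replace (u j k * y ^ k - b k * y ^ k)%C with ((u j k - b k) * y ^ k)%C by ring.
    rewrite Cmod_mult, Cmod_pow.
    specialize (HN j Hj k Hk). specialize (Hyk k). specialize (Hsk k).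
    pose proof (Cmod_ge_0 (u j k - b k)). nra. }
  replace (l - m)%C with ((l - m - csum (fun k => u j k * y ^ k - b k * y ^ k)%C n)
    + csum (fun k => u j k * y ^ k - b k * y ^ k)%C n)%C by ring.
  eapply Rle_trans; [apply Cmod_triangle | ]. lra.
Qed.

(** * Power series with bounded coefficients *)

Definition psum (c : nat -> C) (y : C) : C := CSeries (fun k => c k * y ^ k)%C.

Lemma bounded_geom (c : nat -> C) M s y :
  (forall k, Cmod (c k) <= M) -> Cmod y <= s ->
  forall k, Cmod (c k * y ^ k) <= M * s ^ k.
Proof.
  intros HM Hy k. rewrite Cmod_mult, Cmod_pow.
  apply Rmult_le_compat; [apply Cmod_ge_0 | apply pow_le, Cmod_ge_0 | apply HM | ].
  apply pow_incr. split; [apply Cmod_ge_0 | exact Hy].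
Qed.

Lemma psum_cseries c M y :
  (forall k, Cmod (c k) <= M) -> Cmod y < 1 -> cseries (fun k => c k * y ^ k)%C (psum c y).
Proof.
  intros HM Hy.
  destruct (geom_cvg (fun k => c k * y ^ k)%C M (Cmod y)) as [l Hl].
  - split; [apply Cmod_ge_0 | exact Hy].
  - now apply bounded_geom; [ | apply Rle_refl].
  - unfold psum. now rewrite (CSeries_eq _ _ Hl).
Qed.

Lemma bounded_sum_le c M y (l : C) :
  (forall k, Cmod (c k) <= M) -> Cmod y < 1 -> cseries (fun k => c k * y ^ k)%C l ->
  (1 - Cmod y) * Cmod l <= M.
Proof.
  intros HM Hy Hl.
  pose proof (geom_sum_bound _ M (Cmod y) l (conj (Cmod_ge_0 y) Hy)
    (bounded_geom c M (Cmod y) y HM (Rle_refl _)) Hl) as H.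
  apply Rmult_le_compat_l with (r := 1 - Cmod y) in H; [ | lra].
  replace ((1 - Cmod y) * (M / (1 - Cmod y))) with M in H by (field; lra). exact H.
Qed.

(** The partial sums are polynomials in the inner function and converge
    uniformly, so this re-expands the series around any point. *)
Lemma ana_psum_comp c M R rho s (y : C -> C) :
  (forall k, Cmod (c k) <= M) -> 0 < rho < R -> 0 <= s < 1 -> ana R y ->
  (forall w, Cmod w <= rho -> Cmod (y w) <= s) -> ana rho (fun w => psum c (y w)).
Proof.
  intros HM Hrho Hs Hy Hys.
  destruct (circle_limit_ana R rho (fun j w => csum (fun k => c k * y w ^ k)%C j)
              (fun w => psum c (y w)) Hrho) as [q [Hq Hlim]].
  - intros j. apply ana_csum. intros k. apply ana_mult; [apply ana_const | now apply ana_pow].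
  - intros eps He. destruct (pow_small (M / (1 - s)) s eps Hs He) as [N HN].
    exists N. intros j Hj w Hw.
    assert (Hyw : Cmod (y w) <= s) by (apply Hys; lra).
    rewrite Cmod_minus_sym.
    eapply Rle_trans; [apply (geom_tail _ M s _ j Hs (bounded_geom c M s (y w) HM Hyw)) | ].
    + apply (psum_cseries c M); [exact HM | lra].
    + specialize (HN (S j) ltac:(lia)).
      replace (M * s ^ S j / (1 - s)) with (M / (1 - s) * s ^ S j) by (field; lra). lra.
  - apply ana_ext with q; [ | exact Hq]. intros w Hw.
    apply (tends_unique _ _ _ (Hlim w Hw)).
    apply cseries_tends, (psum_cseries c M); [exact HM | ].
    specialize (Hys w ltac:(lra)). lra.
Qed.

(** * The shifted remainders of a power series *)

(** For [z] in the unit disk this is the sum of [a (m + 1 + k) * z ^ k] over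
    [k >= 0], so it continues the shifted series to wherever [g] is defined. *)
Definition shifted (a : nat -> C) (g : C -> C) (m : nat) (z : C) : C :=
  ((g z - csum (fun n => a n * z ^ n) m) * (/ z) ^ S m)%C.

Lemma cseries_drop u (l : C) n :
  cseries u l -> cseries (fun k => u (S n + k)%nat) (l - csum u n)%C.
Proof.
  intros H. apply (is_series_incr_n (K := C_AbsRing) (V := C_NormedModule) u (S n)); [lia | ].
  change (is_series (K := C_AbsRing) (V := C_NormedModule) u (l - csum u n + csum u n)%C).
  now replace (l - csum u n + csum u n)%C with l by ring.
Qed.

Lemma Cinv_pow_cancel (z : C) n k : z <> 0 -> (z ^ (n + k) * (/ z) ^ n)%C = (z ^ k)%C.
Proof.
  intros Hz. rewrite Cpow_add_r, Cpow_inv by exact Hz. field. now apply Cpow_nz.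
Qed.

Lemma shifted_inside a g m z :
  z <> 0 -> cseries (fun n => a n * z ^ n)%C (g z) ->
  cseries (fun k => a (S m + k)%nat * z ^ k)%C (shifted a g m z).
Proof.
  intros Hz H.
  pose proof (cseries_scal ((/ z) ^ S m)%C _ _ (cseries_drop _ _ m H)) as H'.
  unfold shifted. rewrite Cmult_comm.
  eapply cseries_ext; [ | exact H'].
  intros k. cbv beta. rewrite <- (Cinv_pow_cancel z (S m) k Hz). ring.
Qed.

Lemma csum_S_left u n : csum u (S n) = (u 0%nat + csum (fun k => u (S k)) n)%C.
Proof.
  induction n as [|n IH]; [now rewrite csum_S, !csum_O | ].
  rewrite csum_S, IH, csum_S. ring.
Qed.

(** The coefficients in the variable [1 / z] of the partial sum up to [m],
    divided by [z ^ (m + 1)] and by [1 / z]. *)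
Definition reversed (a : nat -> C) (m k : nat) : C :=
  if le_dec k m then a (m - k)%nat else 0.

Lemma reversed_bound a M m k :
  (forall n, Cmod (a n) <= M) -> Cmod (reversed a m k) <= M.
Proof.
  intros H. unfold reversed. destruct (le_dec k m) as [_ | _]; [apply H | ].
  rewrite Cmod_0. eapply Rle_trans; [apply Cmod_ge_0 | apply (H 0%nat)].
Qed.

Lemma shifted_outside a g m z :
  z <> 0 ->
  exists X, cseries (fun k => reversed a m k * (/ z) ^ k)%C X /\
    shifted a g m z = (g z * (/ z) ^ S m - / z * X)%C.
Proof.
  intros Hz. set (y := (/ z)%C).
  exists (csum (fun k => a (m - k)%nat * y ^ k)%C m). split.
  - apply cseries_finite with m.
    + intros k Hk. unfold reversed. destruct (le_dec k m); [lia | ring].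
    + apply csum_ext. intros k Hk. unfold reversed. now destruct (le_dec k m).
  - unfold shifted. fold y.
    replace (y * csum (fun k => a (m - k)%nat * y ^ k) m)%C
      with (csum (fun n => a n * z ^ n) m * y ^ S m)%C; [ring | ].
    assert (Ey : (y * z)%C = 1) by (unfold y; field; exact Hz).
    induction m as [|m IH].
    + rewrite !csum_O. simpl. ring.
    + rewrite (csum_S (fun n => a n * z ^ n)%C).
      rewrite (csum_S_left (fun k => a (S m - k)%nat * y ^ k)%C).
      transitivity (y * (csum (fun n => a n * z ^ n) m * y ^ S m)
                    + a (S m) * (z ^ S m * y ^ S m) * y)%C; [rewrite (Cpow_S y (S m)); ring | ].
      rewrite IH, <- Cpow_mult_l, (Cmult_comm z y), Ey, Cpow_1_l.
      rewrite (csum_ext (fun k => a (S m - S k)%nat * y ^ S k)%C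
                 (fun k => y * (a (m - k)%nat * y ^ k))%C).
      * rewrite csum_scal. simpl. ring.
      * intros k _. rewrite Cpow_S. simpl. ring.
Qed.

Lemma inv_lt_1 (z : C) : 1 < Cmod z -> z <> 0 /\ Cmod (/ z) < 1.
Proof.
  intros H. assert (Hz : z <> 0) by (apply Cmod_gt_0; lra). split; [exact Hz | ].
  rewrite Cmod_inv by exact Hz. rewrite <- Rinv_1. apply Rinv_lt_contravar; lra.
Qed.

(** Transports a bound in the variable [1 / z] to the distance from [z] to the unit
    circle. *)
Lemma inv_decay (z : C) (B l : R) :
  1 < Cmod z -> (1 - Cmod (/ z)) * l <= B -> (Cmod z - 1) * (Cmod (/ z) * l) <= B.
Proof.
  intros Hz H. destruct (inv_lt_1 z Hz) as [Nz _].
  rewrite Cmod_inv in * by exact Nz.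
  replace ((Cmod z - 1) * (/ Cmod z * l)) with ((1 - / Cmod z) * l) by (field; lra).
  exact H.
Qed.

(** Both one-sided parts are power series with coefficients bounded by [M], in [z]
    or in [1 / z], which accounts for a bound in the inverse of the distance to the
    unit circle; in the exterior, [g z] is only divided by a power of [z]. *)
Lemma shifted_bound a g M B m z :
  (forall n, Cmod (a n) <= M) -> Cmod (g z) <= B ->
  (Cmod z < 1 -> cseries (fun n => a n * z ^ n)%C (g z)) ->
  z <> 0 -> Cmod z <= 2 ->
  Rabs (Cmod z - 1) * Cmod (shifted a g m z) <= B + M.
Proof.
  intros Ha HB Hg Hz H2.
  assert (HB0 : 0 <= B) by (eapply Rle_trans; [apply Cmod_ge_0 | exact HB]).
  assert (HM0 : 0 <= M) by (eapply Rle_trans; [apply Cmod_ge_0 | apply (Ha 0%nat)]).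
  destruct (Rtotal_order (Cmod z) 1) as [Hlt | [Heq | Hgt]].
  - rewrite Rabs_left by lra.
    pose proof (bounded_sum_le (fun k => a (S m + k)%nat) M z _ (fun k => Ha _) Hlt
      (shifted_inside a g m z Hz (Hg Hlt))). lra.
  - rewrite Heq. replace (1 - 1) with 0 by ring. rewrite Rabs_R0. lra.
  - rewrite Rabs_right by lra.
    destruct (shifted_outside a g m z Hz) as [X [HX ->]].
    destruct (inv_lt_1 z Hgt) as [_ Hy].
    pose proof (bounded_sum_le _ M _ _ (fun k => reversed_bound a M m k Ha) Hy HX) as HX'.
    apply inv_decay in HX'; [ | exact Hgt].
    assert (H1 : Cmod (g z * (/ z) ^ S m) <= B).
    { rewrite Cmod_mult, Cmod_pow, <- (Rmult_1_r B).
      apply Rmult_le_compat; [apply Cmod_ge_0 | apply pow_le, Cmod_ge_0 | exact HB | ].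
      rewrite <- (pow1 (S m)). apply pow_incr. split; [apply Cmod_ge_0 | lra]. }
    pose proof (Cmod_minus_le (g z * (/ z) ^ S m) (/ z * X)) as T.
    rewrite (Cmod_mult (/ z)) in T.
    apply Rmult_le_compat_l with (r := Cmod z - 1) in T; [ | lra].
    assert (0 <= Cmod (g z * (/ z) ^ S m)) by apply Cmod_ge_0.
    nra.
Qed.

(** ** The limit of the remainders off the unit circle *)

(** The common form of [f_plus] inside and of minus [f_minus] outside. On the unit
    circle its value is arbitrary: there it only occurs multiplied by 0. *)
Definition two_sided (bp bm : nat -> C) (z : C) : C :=
  if Rlt_dec (Cmod z) 1 then psum bp z else (- (/ z * psum bm (/ z)))%C.

Lemma two_sided_bound bp bm M z :
  (forall k, Cmod (bp k) <= M) -> (forall k, Cmod (bm k) <= M) ->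
  Rabs (Cmod z - 1) * Cmod (two_sided bp bm z) <= M.
Proof.
  intros Hp Hm.
  assert (HM0 : 0 <= M) by (eapply Rle_trans; [apply Cmod_ge_0 | apply (Hp 0%nat)]).
  unfold two_sided. destruct (Rlt_dec (Cmod z) 1) as [Hlt | Hge].
  - rewrite Rabs_left by lra.
    pose proof (bounded_sum_le bp M z _ Hp Hlt (psum_cseries bp M z Hp Hlt)). lra.
  - destruct (Req_dec (Cmod z) 1) as [-> | Hne].
    + replace (1 - 1) with 0 by ring. rewrite Rabs_R0. lra.
    + assert (Hgt : 1 < Cmod z) by lra. destruct (inv_lt_1 z Hgt) as [_ Hy].
      rewrite Rabs_right by lra. rewrite Cmod_opp, Cmod_mult.
      apply inv_decay; [exact Hgt | ].
      exact (bounded_sum_le bm M _ _ Hm Hy (psum_cseries bm M _ Hm Hy)).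
Qed.

(** Inside and outside, apply [bounded_coef_limit] in the variables [z] and [1 / z];
    outside, [g z / z ^ (m + 1)] decays geometrically. *)
Lemma shifted_limit (a : nat -> C) (g : C -> C) (m : nat -> nat) bp bm M B delta :
  (forall n, Cmod (a n) <= M) -> (forall k, Cmod (bp k) <= M) ->
  (forall k, Cmod (bm k) <= M) ->
  (forall K, exists J, forall j, (J <= j)%nat -> (K <= m j)%nat) ->
  (forall k, tends (fun j => a (S (m j) + k)%nat) (bp k)) ->
  (forall k, tends (fun j => a (m j - k)%nat) (bm k)) ->
  0 < delta < 1 ->
  forall eps, 0 < eps -> exists N, forall j, (N <= j)%nat -> forall z,
    z <> 0 -> Cmod (g z) <= B -> delta <= Rabs (Cmod z - 1) ->
    (Cmod z < 1 -> cseries (fun n => a n * z ^ n)%C (g z)) ->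
    Cmod (shifted a g (m j) z - two_sided bp bm z) <= eps.
Proof.
  intros Ha Hp Hm Hmj Hlp Hlm Hd eps He.
  destruct (bounded_coef_limit (fun j k => a (S (m j) + k)%nat) bp M (1 - delta)
    ltac:(lra) (fun j k => Ha _) Hp Hlp eps He) as [N1 HN1].
  assert (Hs : 0 <= / (1 + delta) < 1).
  { split; [left; apply Rinv_0_lt_compat; lra | ].
    rewrite <- Rinv_1. apply Rinv_lt_contravar; lra. }
  destruct (bounded_coef_limit (fun j k => reversed a (m j) k) bm M (/ (1 + delta)) Hs
    (fun j k => reversed_bound a M (m j) k Ha) Hm) with (eps := eps / 2) as [N2 HN2].
  { intros k. destruct (Hmj k) as [J HJ].
    apply tends_ext_from with (fun j => a (m j - k)%nat) J; [ | apply Hlm].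
    intros j Hj. specialize (HJ j Hj). unfold reversed. destruct (le_dec k (m j)); [reflexivity | lia]. }
  { lra. }
  destruct (pow_small B (/ (1 + delta)) (eps / 2) Hs ltac:(lra)) as [K HK].
  destruct (Hmj K) as [N3 HN3].
  exists (max N1 (max N2 N3)). intros j Hj z Hz HB Hdz Hg.
  unfold two_sided. destruct (Rlt_dec (Cmod z) 1) as [Hlt | Hge].
  - rewrite Rabs_left in Hdz by lra.
    apply (HN1 j ltac:(lia) z); [lra | | exact (psum_cseries bp M z Hp Hlt)].
    exact (shifted_inside a g (m j) z Hz (Hg Hlt)).
  - rewrite Rabs_right in Hdz by lra.
    destruct (shifted_outside a g (m j) z Hz) as [X [HX ->]].
    destruct (inv_lt_1 z ltac:(lra)) as [_ Hy].
    assert (Hys : Cmod (/ z) <= / (1 + delta)).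
    { rewrite Cmod_inv by exact Hz. apply Rinv_le_contravar; lra. }
    pose proof (HN2 j ltac:(lia) (/ z)%C X _ Hys HX (psum_cseries bm M _ Hm Hy)) as H2.
    specialize (HK (S (m j)) ltac:(specialize (HN3 j ltac:(lia)); lia)).
    replace (g z * (/ z) ^ S (m j) - / z * X - - (/ z * psum bm (/ z)))%C
      with (g z * (/ z) ^ S (m j) - / z * (X - psum bm (/ z)))%C by ring.
    eapply Rle_trans; [apply Cmod_minus_le | ].
    rewrite !Cmod_mult, Cmod_pow.
    assert (H3 : Cmod (g z) * Cmod (/ z) ^ S (m j) <= B * (/ (1 + delta)) ^ S (m j)).
    { apply Rmult_le_compat; [apply Cmod_ge_0 | apply pow_le, Cmod_ge_0 | exact HB | ].
      apply pow_incr. split; [apply Cmod_ge_0 | exact Hys]. }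
    pose proof (Cmod_ge_0 (X - psum bm (/ z))). pose proof (Cmod_ge_0 (/ z)). nra.
Qed.

(** * Convergence of the remainders across the arc *)

(** The circle of radius [rho] around a point [z0] of the unit circle meets the
    unit circle at [z0 + z0 * s] and [z0 + z0 * Cconj s]. *)
Definition crossing (rho : R) : C := (- rho ^ 2 / 2, rho * sqrt (1 - rho ^ 2 / 4)).

Lemma crossing_sum rho : (crossing rho + Cconj (crossing rho))%C = (- (RtoC rho * RtoC rho))%C.
Proof.
  unfold crossing, Cconj, Cplus, Copp, Cmult, RtoC. simpl. f_equal; field.
Qed.

Lemma crossing_prod rho : 0 < rho < 1 ->
  (crossing rho * Cconj (crossing rho))%C = (RtoC rho * RtoC rho)%C.
Proof.
  intros H. unfold crossing, Cconj, Cmult, RtoC. simpl.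
  set (x := sqrt _).
  assert (E : x * x = 1 - rho ^ 2 / 4) by (unfold x; simpl; apply sqrt_sqrt; nra).
  f_equal; [ | ring].
  transitivity (rho ^ 4 / 4 + rho ^ 2 * (x * x)); [field | ]. rewrite E. field.
Qed.

Lemma Cmod_crossing rho : 0 < rho < 1 -> Cmod (crossing rho) = rho.
Proof.
  intros H. pose proof (Cmod2_conj (crossing rho)) as E.
  rewrite crossing_prod in E by exact H.
  rewrite <- RtoC_mult in E. apply RtoC_inj in E.
  pose proof (Cmod_ge_0 (crossing rho)). nra.
Qed.

(** On the circle [Cmod w = rho] one has [Cconj w = rho ^ 2 / w], so that
    [Cmod (z0 + w) ^ 2 - 1] is there a polynomial in [w] up to the factor [z0 * w];
    its roots are the crossing points. *)
Lemma crossing_factor z0 w rho :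
  Cmod z0 = 1 -> 0 < rho < 1 -> Cmod w = rho ->
  Cmod ((- (z0 * crossing rho) + w) * (- (z0 * Cconj (crossing rho)) + w))
  = rho * Rabs (Cmod (z0 + w) ^ 2 - 1).
Proof.
  intros Hz0 Hrho Hw.
  assert (E0 : (z0 * Cconj z0)%C = 1) by (rewrite <- Cmod2_conj, Hz0; f_equal; ring).
  assert (Ew : (w * Cconj w)%C = (RtoC rho * RtoC rho)%C).
  { rewrite <- Cmod2_conj, Hw, <- RtoC_mult. f_equal. ring. }
  replace ((- (z0 * crossing rho) + w) * (- (z0 * Cconj (crossing rho)) + w))%C
    with (z0 * (w * RtoC (Cmod (z0 + w) ^ 2 - 1)))%C.
  - rewrite !Cmod_mult, Hz0, Hw, Cmod_R. ring.
  - rewrite RtoC_minus, Cmod2_conj, Cplus_conj.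
    transitivity (w * w - z0 * w * (crossing rho + Cconj (crossing rho))
                  + z0 * z0 * (crossing rho * Cconj (crossing rho)))%C; [ | ring].
    rewrite crossing_sum, crossing_prod by exact Hrho.
    transitivity (z0 * w * ((z0 * Cconj z0) - 1 + w * Cconj w)
                  + w * w * (z0 * Cconj z0) + z0 * z0 * (w * Cconj w))%C; [ring | ].
    rewrite E0, Ew. ring.
Qed.

(** The remainders, multiplied by a polynomial that tames them where the small
    circle crosses the unit circle, converge uniformly on the small circle, hence
    converge to a power series inside it. *)
Lemma shifted_limit_on_arc (a : nat -> C) g (m : nat -> nat) bp bm M z0 :
  (forall n, Cmod (a n) <= M) -> (forall k, Cmod (bp k) <= M) ->
  (forall k, Cmod (bm k) <= M) ->
  (forall K, exists J, forall j, (J <= j)%nat -> (K <= m j)%nat) ->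
  (forall k, tends (fun j => a (S (m j) + k)%nat) (bp k)) ->
  (forall k, tends (fun j => a (m j - k)%nat) (bm k)) ->
  (forall z, Cmod z < 1 -> cseries (fun n => a n * z ^ n)%C (g z)) ->
  Cmod z0 = 1 -> analytic_at g z0 ->
  exists rho q, 0 < rho < 1 /\ ana rho q /\
    (forall w, Cmod w < rho -> tends (fun j => shifted a g (m j) (z0 + w)%C) (q w)) /\
    (forall w, Cmod w < rho -> Cmod (z0 + w) <> 1 -> two_sided bp bm (z0 + w)%C = q w).
Proof.
  intros Ha Hp Hm Hmj Hlp Hlm Hg Hz0 Hana.
  destruct (analytic_at_ana g z0 Hana) as [r [Hr Hgr]].
  set (R0 := Rmin r 1).
  assert (HR0 : 0 < R0 <= 1) by (unfold R0; split; [apply Rmin_glb_lt; lra | apply Rmin_r]).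
  assert (HgR0 : ana R0 (fun w => g (z0 + w)%C)) by (apply ana_le with r; [apply Rmin_l | exact Hgr]).
  (* [rho <= 1 / 2] keeps the small disk away from 0 and [Cmod (h w)] below 1 on
     its boundary. *)
  set (rho := R0 / 2).
  assert (Hrho : 0 < rho <= 1 / 2) by (unfold rho; lra).
  assert (HrR : 0 < rho < R0) by (unfold rho; lra).
  assert (HB : exists B, forall w, Cmod w <= rho -> Cmod (g (z0 + w)%C) <= B).
  { destruct HgR0 as [c Hc].
    destruct (expands_geom c R0 _ rho Hc ltac:(lra)) as [B [s [Hs HB]]].
    exists (B / (1 - s)). intros w Hw.
    apply (geom_sum_bound _ B s _ Hs (HB w Hw)). apply Hc. lra. }
  destruct HB as [B HB].
  assert (Hnear : forall w, Cmod w <= rho -> 1 / 2 <= Cmod (z0 + w) <= 3 / 2).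
  { intros w Hw. pose proof (Cmod_triangle z0 w) as T.
    pose proof (Cmod_minus_le (z0 + w) w) as T'.
    replace (z0 + w - w)%C with z0 in T' by ring. lra. }
  assert (Hnz : forall w, Cmod w <= rho -> (z0 + w)%C <> 0).
  { intros w Hw. apply Cmod_gt_0. specialize (Hnear w Hw). lra. }
  set (x1 := (- (z0 * crossing rho))%C). set (x2 := (- (z0 * Cconj (crossing rho)))%C).
  assert (Hx1 : Cmod x1 = rho)
    by (unfold x1; rewrite Cmod_opp, Cmod_mult, Hz0, Cmod_crossing by lra; ring).
  assert (Hx2 : Cmod x2 = rho)
    by (unfold x2; rewrite Cmod_opp, Cmod_mult, Hz0, Cmod_conj, Cmod_crossing by lra; ring).
  (* [h] vanishes exactly at the two crossing points, which lie on the circle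
     [Cmod w = rho]; so it is invertible inside. *)
  set (h := fun w => ((x1 + w) * (x2 + w))%C).
  assert (Hh : forall w, Cmod w = rho -> Cmod (h w) <= 2 * Rabs (Cmod (z0 + w) - 1)
                           /\ Rabs (Cmod (z0 + w) - 1) <= 1 / 2).
  { intros w Hw. specialize (Hnear w (Req_le _ _ Hw)).
    split; [ | apply Rabs_le; lra].
    unfold h, x1, x2. rewrite crossing_factor by (try exact Hw; try exact Hz0; lra).
    replace (Cmod (z0 + w) ^ 2 - 1) with ((Cmod (z0 + w) - 1) * (Cmod (z0 + w) + 1)) by ring.
    rewrite Rabs_mult, (Rabs_pos_eq (Cmod (z0 + w) + 1)) by lra.
    pose proof (Rabs_pos (Cmod (z0 + w) - 1)) as Hpos.
    replace (rho * (Rabs (Cmod (z0 + w) - 1) * (Cmod (z0 + w) + 1)))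
      with (Rabs (Cmod (z0 + w) - 1) * (rho * (Cmod (z0 + w) + 1))) by ring.
    rewrite Rmult_comm. apply Rmult_le_compat_r; [exact Hpos | nra]. }
  assert (Hhana : ana R0 (fun w => h w * h w)%C).
  { assert (ana R0 h) by (apply ana_mult; (apply ana_plus; [apply ana_const | apply ana_id])).
    now apply ana_mult. }
  set (K := B + 2 * M).
  assert (HM0 : 0 <= M) by (eapply Rle_trans; [apply Cmod_ge_0 | apply (Ha 0%nat)]).
  assert (HB0 : 0 <= B).
  { eapply Rle_trans; [apply Cmod_ge_0 | apply (HB (RtoC 0))]. rewrite Cmod_0. lra. }
  assert (HK : forall j w, Cmod w <= rho -> Rabs (Cmod (z0 + w) - 1) *
      Cmod (shifted a g (m j) (z0 + w) - two_sided bp bm (z0 + w)) <= K).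
  { intros j w Hw. specialize (Hnear w Hw).
    pose proof (shifted_bound a g M B (m j) (z0 + w)%C Ha (HB w Hw) (Hg _) (Hnz w Hw)
      ltac:(lra)) as H1.
    pose proof (two_sided_bound bp bm M (z0 + w)%C Hp Hm) as H2.
    pose proof (Rabs_pos (Cmod (z0 + w) - 1)).
    pose proof (Cmod_minus_le (shifted a g (m j) (z0 + w)) (two_sided bp bm (z0 + w))) as T.
    unfold K. nra. }
  destruct (circle_limit_ana R0 rho
    (fun j w => shifted a g (m j) (z0 + w) * (h w * h w))%C
    (fun w => two_sided bp bm (z0 + w) * (h w * h w))%C HrR) as [q [Hq Hlim]].
  - intros j. apply ana_mult; [ | exact Hhana].
    apply ana_mult.
    + apply ana_minus; [exact HgR0 | ].
      apply (ana_csum R0 (fun n w => a n * (z0 + w) ^ n)%C). intros n.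
      apply ana_mult; [apply ana_const | ].
      apply ana_pow, ana_plus; [apply ana_const | apply ana_id].
    + apply ana_pow, ana_inv; lra.
  - intros eps He.
    (* Within [delta] of the unit circle the square of [h] beats the bound
       [K / t] at distance [t] for the difference, leaving at most [4 * K * delta]; farther away
       the difference itself is uniformly small and [Cmod (h w) <= 1]. *)
    set (delta := Rmin (1 / 2) (eps / (4 * K + 1))).
    assert (HK0 : 0 <= K) by (unfold K; lra).
    assert (Hq0 : 0 < eps / (4 * K + 1)) by (apply Rdiv_lt_0_compat; lra).
    assert (Hdelta : 0 < delta <= 1 / 2)
      by (unfold delta; split; [apply Rmin_glb_lt; lra | apply Rmin_l]).
    assert (Hdelta2 : 4 * K * delta <= eps).
    { apply Rle_trans with ((4 * K + 1) * (eps / (4 * K + 1))); [ | right; field; lra].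
      assert (delta <= eps / (4 * K + 1)) by apply Rmin_r. nra. }
    destruct (shifted_limit a g m bp bm M B delta Ha Hp Hm Hmj Hlp Hlm ltac:(lra) eps He)
      as [N HN].
    exists N. intros j Hj w Hw.
    assert (Hw' : Cmod w <= rho) by lra.
    replace (shifted a g (m j) (z0 + w) * (h w * h w) - two_sided bp bm (z0 + w) * (h w * h w))%C
      with ((shifted a g (m j) (z0 + w) - two_sided bp bm (z0 + w)) * (h w * h w))%C by ring.
    rewrite !Cmod_mult.
    specialize (HK j w Hw'). destruct (Hh w Hw) as [Hh1 Hh2].
    pose proof (Cmod_ge_0 (h w)) as Hh0.
    pose proof (Rabs_pos (Cmod (z0 + w) - 1)) as Ht0.
    destruct (Rle_lt_dec delta (Rabs (Cmod (z0 + w) - 1))) as [Hfar | Hclose].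
    + specialize (HN j Hj (z0 + w)%C (Hnz w Hw') (HB w Hw') Hfar (Hg _)).
      set (D := Cmod (_ - _)) in *. assert (0 <= D) by apply Cmod_ge_0.
      assert (Cmod (h w) * Cmod (h w) <= 1) by nra.
      assert (0 <= Cmod (h w) * Cmod (h w)) by nra.
      nra.
    + set (D := Cmod (shifted a g (m j) (z0 + w) - two_sided bp bm (z0 + w))) in *.
      assert (HD : 0 <= D) by apply Cmod_ge_0.
      set (t := Rabs (Cmod (z0 + w) - 1)) in *.
      assert (H1 : Cmod (h w) * Cmod (h w) <= 4 * t * t) by nra.
      apply Rle_trans with (D * (4 * t * t)); [now apply Rmult_le_compat_l | ].
      replace (D * (4 * t * t)) with (4 * (t * D) * t) by ring.
      apply Rle_trans with (4 * K * delta); [ | exact Hdelta2].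
      apply Rmult_le_compat; nra.
  - (* Divide the limit by the square of [h]. *)
    set (k := fun w => ((/ (x1 + w) * / (x2 + w)) * (/ (x1 + w) * / (x2 + w)))%C).
    assert (Hk : ana rho k).
    { assert (ana rho (fun w => / (x1 + w) * / (x2 + w))%C)
        by (apply ana_mult; apply ana_inv; lra).
      now apply ana_mult. }
    assert (Hkh : forall w, Cmod w < rho -> (k w * (h w * h w))%C = 1).
    { intros w Hw.
      assert (Hne : forall x : C, Cmod x = rho -> (x + w)%C <> 0).
      { intros x Hx E. replace x with (x + w - w)%C in Hx by ring.
        rewrite E in Hx. replace (0 - w)%C with (- w)%C in Hx by ring.
        rewrite Cmod_opp in Hx. lra. }
      unfold k, h. field. split; apply Hne; assumption. }
    assert (Hlimq : forall w, Cmod w < rho ->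
              tends (fun j => shifted a g (m j) (z0 + w)%C) (k w * q w)%C).
    { intros w Hw.
      apply tends_ext_from with (2 := tends_scal (k w) _ _ (Hlim w Hw)) (n0 := 0%nat).
      intros j _.
      transitivity (shifted a g (m j) (z0 + w) * (k w * (h w * h w)))%C; [ring | ].
      rewrite Hkh by exact Hw. ring. }
    exists rho, (fun w => k w * q w)%C. repeat split; try lra.
    + now apply ana_mult.
    + exact Hlimq.
    + intros w Hw Hne. apply (tends_unique (fun j => shifted a g (m j) (z0 + w)%C));
        [ | now apply Hlimq].
      assert (Hw' : Cmod w <= rho) by lra. specialize (Hnear w Hw').
      set (t := Rabs (Cmod (z0 + w) - 1)).
      assert (Ht : 0 < t <= 1 / 2).
      { unfold t. split; [apply Rabs_pos_lt; lra | apply Rabs_le; lra]. }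
      intros eps He.
      destruct (shifted_limit a g m bp bm M B t Ha Hp Hm Hmj Hlp Hlm ltac:(lra)
                  (eps / 2) ltac:(lra)) as [N HN].
      exists N. intros j Hj.
      specialize (HN j Hj (z0 + w)%C (Hnz w Hw') (HB w Hw') (Rle_refl _) (Hg _)). lra.
Qed.

(** * Right limits *)

(** The shift is [m j + 1] with [m j = nj j - 1], because [csum _ m] has the
    [m + 1] terms of index at most [m]. *)
Lemma right_limit_tends (a : nat -> C) (b : Z -> C) :
  right_limit a b ->
  exists m : nat -> nat,
    (forall K, exists J, forall j, (J <= j)%nat -> (K <= m j)%nat) /\
    (forall k, tends (fun j => a (S (m j) + k)%nat) (b (Z.of_nat k))) /\
    (forall k, tends (fun j => a (m j - k)%nat) (b (- Z.of_nat (S k))%Z)).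
Proof.
  intros [nj [Hinf Hlim]].
  exists (fun j => Z.to_nat (nj j - 1)).
  assert (Hlarge : forall K : nat, exists J, forall j, (J <= j)%nat -> (Z.of_nat K < nj j)%Z).
  { intros K. destruct (proj2 (is_lim_seq_spec _ _) Hinf (IZR (Z.of_nat K))) as [J HJ].
    exists J. intros j Hj. apply lt_IZR, HJ, Hj. }
  repeat split.
  - intros K. destruct (Hlarge K) as [J HJ]. exists J. intros j Hj.
    specialize (HJ j Hj). lia.
  - intros k. destruct (Hlarge 0%nat) as [J HJ].
    apply tends_ext_from with (2 := proj2 (tends_filterlim _ _) (Hlim (Z.of_nat k))) (n0 := J).
    intros j Hj. f_equal. specialize (HJ j Hj). lia.
  - intros k. destruct (Hlarge (S k)) as [J HJ].
    apply tends_ext_from with (2 := proj2 (tends_filterlim _ _) (Hlim (- Z.of_nat (S k))%Z))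
      (n0 := J).
    intros j Hj. f_equal. specialize (HJ j Hj). lia.
Qed.

Lemma right_limit_bound (a : nat -> C) (b : Z -> C) M :
  (forall n, Cmod (a n) <= M) -> right_limit a b -> forall n, Cmod (b n) <= M.
Proof.
  intros Ha [nj [_ Hlim]] n.
  apply (tends_bound _ _ _ (proj2 (tends_filterlim _ _) (Hlim n))).
  exists 0%nat. intros j _. apply Ha.
Qed.

Lemma f_minus_psum (b : Z -> C) M z :
  (forall n, Cmod (b n) <= M) -> 1 < Cmod z ->
  f_minus b (Fin z) = (/ z * psum (fun k => b (- Z.of_nat (S k))%Z) (/ z))%C.
Proof.
  intros Hb Hz. destruct (inv_lt_1 z Hz) as [_ Hy].
  apply CSeries_eq.
  eapply cseries_ext; [ | exact (cseries_scal (/ z)%C _ _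
    (psum_cseries (fun k => b (- Z.of_nat (S k))%Z) M _ (fun k => Hb _) Hy))].
  intros k. cbv beta. rewrite Cpow_S. ring.
Qed.

Theorem theorem1p3 (a : nat -> C) (f : C -> C) (I : C -> Prop)
  (ha : exists M : R, forall n : nat, Cmod (a n) <= M)
  (hf : forall z : C, disk z -> f z = CSeries (fun n => (a n * z ^ n)%C))
  (hI : open_arc I)
  (hcont : continues_near f I) :
  forall b : Z -> C, right_limit a b -> reflectionless b I.
Proof.
  intros b Hb.
  destruct ha as [M Ha].
  destruct hcont as [U [g [_ [HIU [Hana Hgf]]]]].
  pose proof (right_limit_bound a b M Ha Hb) as HbM.
  split; [now exists M | ].
  destruct (right_limit_tends a b Hb) as [m [Hmj [Hlp Hlm]]].
  set (bp := fun k => b (Z.of_nat k)) in *.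
  set (bm := fun k => b (- Z.of_nat (S k))%Z) in *.
  assert (Hp : forall k, Cmod (bp k) <= M) by (intros k; apply HbM).
  assert (Hm : forall k, Cmod (bm k) <= M) by (intros k; apply HbM).
  assert (Hg : forall z, Cmod z < 1 -> cseries (fun n => a n * z ^ n)%C (g z)).
  { intros z Hz. rewrite (Hgf z Hz), (hf z Hz). now apply (psum_cseries a M). }
  (* On the unit circle the value is prescribed as the limit of the remainders,
     which exists near every point of the arc. *)
  set (lim := fun z => epsilon (inhabits (RtoC 0)) (fun l => tends (fun j => shifted a g (m j) z) l)).
  set (F := fun p : sphere => match p with
    | Inf => RtoC 0
    | Fin z => if Req_EM_T (Cmod z) 1 then lim z else two_sided bp bm z
    end).
  assert (Fin_in : forall z, Cmod z < 1 -> F (Fin z) = psum bp z).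
  { intros z Hz. unfold F, two_sided.
    destruct (Req_EM_T (Cmod z) 1); [lra | ]. destruct (Rlt_dec (Cmod z) 1); [reflexivity | lra]. }
  assert (Fin_out : forall z, 1 < Cmod z -> F (Fin z) = (- (/ z * psum bm (/ z)))%C).
  { intros z Hz. unfold F, two_sided.
    destruct (Req_EM_T (Cmod z) 1); [lra | ]. destruct (Rlt_dec (Cmod z) 1); [lra | reflexivity]. }
  exists F. split; [ | split].
  - intros [z0 | ] Hslit; cbn [sphere_analytic_at].
    + destruct (Rtotal_order (Cmod z0) 1) as [Hlt | [Heq | Hgt]].
      * set (rho := (1 - Cmod z0) / 2). pose proof (Cmod_ge_0 z0).
        assert (Hrho : 0 < rho < 1) by (unfold rho; lra).
        assert (Hin : forall w, Cmod w <= rho -> Cmod (z0 + w) <= (1 + Cmod z0) / 2).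
        { intros w Hw. eapply Rle_trans; [apply Cmod_triangle | ]. unfold rho in Hw. lra. }
        apply ana_analytic_at with rho (fun w => psum bp (z0 + w)%C); [lra | | ].
        -- apply ana_psum_comp with M 1 ((1 + Cmod z0) / 2); [exact Hp | lra | lra | | exact Hin].
           apply ana_plus; [apply ana_const | apply ana_id].
        -- intros w Hw. apply Fin_in. specialize (Hin w ltac:(lra)). lra.
      * assert (HI : I z0) by (apply NNPP; intros Hn; apply Hslit; now split).
        destruct (shifted_limit_on_arc a g m bp bm M z0 Ha Hp Hm Hmj Hlp Hlm Hg Heq
          (Hana z0 (or_intror (HIU z0 HI)))) as [rho [q [Hrho [Hq [Hlim Hoff]]]]].
        apply ana_analytic_at with rho q; [lra | exact Hq | ].
        intros w Hw. unfold F. destruct (Req_EM_T (Cmod (z0 + w)) 1) as [Hon | Hne].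
        -- apply (tends_unique (fun j => shifted a g (m j) (z0 + w)%C)); [ | now apply Hlim].
           unfold lim. apply epsilon_spec. exists (q w). now apply Hlim.
        -- now apply Hoff.
      * set (rho := (Cmod z0 - 1) / 2).
        assert (Hrho : 0 < rho < Cmod z0) by (unfold rho; lra).
        assert (Hout : forall w, Cmod w <= rho -> (1 + Cmod z0) / 2 <= Cmod (z0 + w)).
        { intros w Hw. pose proof (Cmod_minus_le (z0 + w) w) as T.
          replace (z0 + w - w)%C with z0 in T by ring. unfold rho in Hw. lra. }
        assert (Hy : ana (Cmod z0) (fun w => / (z0 + w))%C) by (apply ana_inv; lra).
        apply ana_analytic_at with rho
          (fun w => RtoC 0 - (/ (z0 + w) * psum bm (/ (z0 + w))))%C; [lra | | ].
        -- apply ana_minus; [apply ana_const | ]. apply ana_mult.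
           ++ apply ana_le with (Cmod z0); [lra | exact Hy].
           ++ apply ana_psum_comp with M (Cmod z0) (/ ((1 + Cmod z0) / 2)); try assumption.
              ** split; [left; apply Rinv_0_lt_compat; lra | ].
                 rewrite <- Rinv_1. apply Rinv_lt_contravar; lra.
              ** intros w Hw. specialize (Hout w Hw).
                 rewrite Cmod_inv by (apply Cmod_gt_0; lra).
                 apply Rinv_le_contravar; lra.
        -- intros w Hw. specialize (Hout w ltac:(lra)). cbv beta.
           rewrite Fin_out by lra. ring.
    + apply ana_analytic_at with (1 / 2) (fun w => RtoC 0 - (w * psum bm w))%C; [lra | | ].
      * apply ana_minus; [apply ana_const | ]. apply ana_mult; [apply ana_id | ].
        apply ana_psum_comp with M 1 (1 / 2); try lra; [exact Hm | apply ana_id | auto].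
      * intros w Hw. replace (0 + w)%C with w by ring.
        unfold inv_sphere. destruct (Ceq_dec w 0) as [-> | Hne].
        -- simpl. ring.
        -- assert (H0 : 0 < Cmod w) by now apply Cmod_gt_0.
           assert (Ei : (/ / w)%C = w) by (field; exact Hne).
           rewrite Fin_out, Ei; [ring | ].
           rewrite Cmod_inv by exact Hne. rewrite <- Rinv_1. apply Rinv_lt_contravar; lra.
  - intros z Hz. exact (Fin_in z Hz).
  - intros [z | ] Hext.
    + rewrite (f_minus_psum b M z HbM Hext), (Fin_out z Hext). fold bm. ring.
    + simpl. ring.
Qed.
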